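(* Let $X$ be a set and let $d$, $d'$ be two metrics on $X$, both bounded above by $1$, which induce the same topology on $X$. Let $H$ be the set of compact subsets of $X$ (with respect to this common topology). Then the Hausdorff metrics $d_H$ and $d'_H$ on $H$ associated with $d$ and $d'$ induce the same topology on $H$. In other words, the topology on $H$ determined by the Hausdorff metric $d_H$ depends on the metric $d$ only through the topology on $X$ determined by $d$.
   Context: For a metric $d\le 1$ on $X$, the Hausdorff metric $d_H$ on the set $H$ of compact subsets of $X$ (including $\emptyset$) is defined as follows: for non-empty $A,B\in H$, $$d_H(A,B) := \max\Big( \sup_{a \in A} \inf_{b \in B} d(a,b),\ \sup_{b \in B} \inf_{a \in A} d(a,b) \Big),$$ $d_H(A,\emptyset)=d_H(\emptyset,A)=1$ for $A\neq\emptyset$, and $d_H(\emptyset,\emptyset)=0$. *)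

(* Defs.v *)
From HB Require Import structures.
From mathcomp Require Import all_boot all_order all_algebra.
From mathcomp Require Import all_classical all_reals.
From mathcomp Require Import topology.

Set Implicit Arguments.
Unset Strict Implicit.
Unset Printing Implicit Defensive.

Import Order.TTheory GRing.Theory Num.Theory.

Local Open Scope classical_set_scope.
Local Open Scope ring_scope.

(* The fields are those of the factory [isMetric]; having them as a first-class
   value lets one carrier carry several metrics at once. *)
Record metric (R : realType) (X : Type) := {
  dist :> X -> X -> R ;
  dist_xx : forall x, dist x x = 0 ;
  dist_positivity : forall x y, dist x y = 0 -> x = y ;
  dist_sym : forall x y, dist x y = dist y x ;
  dist_triangle : forall y x z, dist x z <= dist x y + dist y z
}.

(* Alias of [X] equipped with the [metricType] structure of [d]. *)
Definition metric_space (R : realType) (X : Type) (d : metric R X) : Type := X.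

HB.instance Definition _ (R : realType) (X : Type) (d : metric R X) :=
  gen_eqMixin (metric_space d).
HB.instance Definition _ (R : realType) (X : Type) (d : metric R X) :=
  gen_choiceMixin (metric_space d).
HB.instance Definition _ (R : realType) (X : Type) (d : metric R X) :=
  isMetric.Build R (metric_space d)
    (dist_xx d) (@dist_positivity R X d) (dist_sym d) (dist_triangle d).

Definition metric_topology (R : realType) (X : Type) (d : metric R X) :
  set_system X := @open (metric_space d).

Definition compact_subsets (R : realType) (X : Type) (d : metric R X) :
  set (set X) := [set A | @compact (metric_space d) A].

Lemma compact_subsets_eq (R : realType) (X : Type) (d d' : metric R X) :
  metric_topology d = metric_topology d' ->
  compact_subsets d = compact_subsets d'.
Proof.
move=> dd'; have nbhs_dd' x :
    @nbhs _ (metric_space d) x = @nbhs _ (metric_space d') x.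
  rewrite [LHS](@nbhsE (metric_space d)) [RHS](@nbhsE (metric_space d')).
  by rewrite /open_nbhs -/(metric_topology d) -/(metric_topology d') dd'.
rewrite /compact_subsets /compact /cluster /=.
by apply/seteqP; split=> A cA F FF FA; have [x [Ax Fx]] := cA F FF FA;
  exists x; split=> // U V FU xV; apply: Fx => //; move: xV;
  rewrite -?nbhs_dd' // nbhs_dd'.
Qed.

(* [sup] and [inf] are only meaningful on nonempty bounded sets, which they are
   applied to when [d] is bounded. *)
Definition hausdorff_dist (R : realType) (X : Type) (d : X -> X -> R)
    (A B : set X) : R :=
  if A == set0 then (if B == set0 then 0 else 1) else
  if B == set0 then 1 else
  Num.max (sup [set inf [set d a b | b in B] | a in A])
          (sup [set inf [set d a b | a in A] | b in B]).

Section hausdorff_metric.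
Context (R : realType) (X : Type) (d : metric R X).
Context (d1 : forall x y, d x y <= 1).
Implicit Types A B C : set X.

#[local] Lemma d_ge0 x y : 0 <= d x y.
Proof. exact: (@mdist_ge0 _ (metric_space d) x y). Qed.

Local Notation infs A B := [set inf [set d a b | b in B] | a in A].

#[local] Lemma ex_dist_lt a B r : B !=set0 -> inf [set d a b | b in B] < r ->
  exists2 b, B b & d a b < r.
Proof.
move=> [b Bb] /inf_lt[|_ [c Bc <-] acr]; last by exists c.
by exists (d a b), b.
Qed.

#[local] Lemma inf_le_dist a b B : B b -> inf [set d a b | b in B] <= d a b.
Proof. by move=> Bb; apply: ge_inf; [exists 0 => _ [c _ <-]; exact: d_ge0|exists b]. Qed.

#[local] Lemma infs_ub1 A B : B !=set0 -> ubound (infs A B) 1.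
Proof.
by move=> [b Bb] _ [a _ <-]; rewrite (le_trans (inf_le_dist a Bb)).
Qed.

#[local] Lemma infs_lt A B r : B !=set0 -> sup (infs A B) < r ->
  forall a, A a -> exists2 b, B b & d a b < r.
Proof.
move=> B0 ABr a Aa; apply: ex_dist_lt => //; apply: le_lt_trans ABr.
by apply: ub_le_sup; [exists 1; exact: infs_ub1|exists a].
Qed.

#[local] Lemma infs_le A B r : A !=set0 ->
  (forall a, A a -> exists2 b, B b & d a b <= r) ->
  sup (infs A B) <= r.
Proof.
move=> [a Aa] ABr; apply: ge_sup; first by eexists; exists a.
by move=> _ [c /ABr[b Bb cbr] <-]; rewrite (le_trans (inf_le_dist c Bb)).
Qed.

#[local] Lemma infs_sym A B :
  [set inf [set d a b | a in A] | b in B] = infs B A.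
Proof.
congr image; apply/funext => b; congr inf; congr image.
by apply/funext => a; rewrite dist_sym.
Qed.

#[local] Lemma hdE A B : A !=set0 -> B !=set0 ->
  hausdorff_dist d A B = Num.max (sup (infs A B)) (sup (infs B A)).
Proof.
move=> /set0P/negPf A0 /set0P/negPf B0.
by rewrite /hausdorff_dist A0 B0 infs_sym.
Qed.

Lemma hausdorff_dist_sym A B : hausdorff_dist d A B = hausdorff_dist d B A.
Proof.
rewrite /hausdorff_dist; case: ifP => _; case: ifP => // _.
by rewrite !infs_sym maxC.
Qed.

Lemma hausdorff_dist_xx A : hausdorff_dist d A A = 0.
Proof.
have [->|/set0P A0] := eqVneq A set0; first by rewrite /hausdorff_dist eqxx.
rewrite hdE// maxxx; apply/eqP; rewrite eq_le; apply/andP; split.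
  by apply: infs_le => // a Aa; exists a => //; rewrite dist_xx.
rewrite leNgt; apply/negP => /infs_lt H.
by have [a Aa] := A0; have [b _] := H A0 a Aa; rewrite ltNge d_ge0.
Qed.

Lemma hausdorff_dist_lt A B r : A !=set0 -> B !=set0 ->
  hausdorff_dist d A B < r -> forall a, A a -> exists2 b, B b & d a b < r.
Proof.
by move=> A0 B0; rewrite hdE// gt_max => /andP[ABr _]; exact: infs_lt.
Qed.

Lemma hausdorff_dist_le A B r : A !=set0 -> B !=set0 ->
  (forall a, A a -> exists2 b, B b & d a b <= r) ->
  (forall b, B b -> exists2 a, A a & d a b <= r) ->
  hausdorff_dist d A B <= r.
Proof.
move=> A0 B0 AB BA; rewrite hdE// ge_max !infs_le// => b /BA[a Aa abr].
by exists a; rewrite // dist_sym.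
Qed.

Lemma hausdorff_dist_ge0 A B : 0 <= hausdorff_dist d A B.
Proof.
have [->|A0] := eqVneq A set0; first by rewrite /hausdorff_dist eqxx; case: ifP.
have [->|B0] := eqVneq B set0.
  by rewrite /hausdorff_dist eqxx (negPf A0).
move: A0 B0 => /set0P A0 /set0P B0; have [a Aa] := A0.
rewrite leNgt; apply/negP => /(hausdorff_dist_lt A0 B0)/(_ a Aa)[b _].
by rewrite ltNge d_ge0.
Qed.

Lemma hausdorff_dist_le1 A B : hausdorff_dist d A B <= 1.
Proof.
have [->|A0] := eqVneq A set0; first by rewrite /hausdorff_dist eqxx; case: ifP.
have [->|B0] := eqVneq B set0.
  by rewrite /hausdorff_dist eqxx (negPf A0).
move: A0 B0 => /set0P[a Aa] /set0P[b Bb].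
apply: hausdorff_dist_le; [by exists a|by exists b| |].
- by move=> x _; exists b.
- by move=> x _; exists a.
Qed.

Lemma hausdorff_dist_triangle B A C :
  hausdorff_dist d A C <= hausdorff_dist d A B + hausdorff_dist d B C.
Proof.
have [->|A0] := eqVneq A set0.
  have [->|B0] := eqVneq B set0.
    by rewrite hausdorff_dist_xx add0r.
  rewrite {2}/hausdorff_dist eqxx (negPf B0).
  by rewrite (le_trans (hausdorff_dist_le1 _ _))// lerDl hausdorff_dist_ge0.
have [->|B0] := eqVneq B set0.
  rewrite {2}/hausdorff_dist eqxx (negPf A0).
  by rewrite (le_trans (hausdorff_dist_le1 _ _))// lerDl hausdorff_dist_ge0.
have [->|C0] := eqVneq C set0.
  rewrite {3}/hausdorff_dist eqxx (negPf B0).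
  by rewrite (le_trans (hausdorff_dist_le1 _ _))// lerDr hausdorff_dist_ge0.
move: A0 B0 C0 => /set0P A0 /set0P B0 /set0P C0.
apply/ler_addgt0Pl => /= e e0.
have e2 : 0 < e / 2 by rewrite divr_gt0.
have lt_e D E : hausdorff_dist d D E < hausdorff_dist d D E + e / 2.
  by rewrite ltrDl.
have key D E F : D !=set0 -> E !=set0 -> F !=set0 -> forall x, D x ->
    exists2 z, F z &
      d x z <= e + (hausdorff_dist d D E + hausdorff_dist d E F).
  move=> D0 E0 F0 x Dx.
  have [y Ey xy] := hausdorff_dist_lt D0 E0 (lt_e D E) Dx.
  have [z Fz yz] := hausdorff_dist_lt E0 F0 (lt_e E F) Ey.
  exists z => //; rewrite (le_trans (dist_triangle d y x z))//.
  rewrite (le_trans (ltW (ltrD xy yz)))//.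
  by rewrite addrACA -splitr addrC.
apply: hausdorff_dist_le => // [a /(key _ _ _ A0 B0 C0)//|].
move=> c /(key _ _ _ C0 B0 A0)[a Aa ca]; exists a => //.
rewrite dist_sym (le_trans ca)// (hausdorff_dist_sym C B).
by rewrite (hausdorff_dist_sym B A) [X in _ + X]addrC.
Qed.

Lemma hausdorff_dist_subset A B : compact_subsets d B ->
  hausdorff_dist d A B = 0 -> A `<=` B.
Proof.
move=> cB AB0 a Aa.
have A0 : A !=set0 by exists a.
have [B0|/set0P B0] := eqVneq B set0.
  move: AB0; rewrite /hausdorff_dist B0 eqxx; move/set0P/negPf : A0 => ->.
  by move/eqP; rewrite oner_eq0.
have clB : @closed (metric_space d) B.
  by apply: compact_closed cB; exact: (@metric_hausdorff R (metric_space d)).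
apply: clB => U.
rewrite -(@metricType_numDomainType.filter_from_mdist_nbhs R (metric_space d)).
move=> [e e0 eU]; have [|b Bb abe] := hausdorff_dist_lt A0 B0 _ Aa (r := e).
  by rewrite AB0.
by exists b; split => //; exact: eU.
Qed.

Section on_compact_subsets.
(* [H] is an independent parameter, rather than [compact_subsets d], so that
   the Hausdorff metrics of two metrics on [X] can live on the same type. *)
Context (H : set (set X)) (HE : H = compact_subsets d).

Lemma hausdorff_dist_positivity (A B : H) :
  hausdorff_dist d (val A) (val B) = 0 -> A = B.
Proof.
have cH (C : H) : compact_subsets d (val C) by rewrite -HE; exact: set_valP.
move=> AB0; apply/val_inj/seteqP; split.
  exact: hausdorff_dist_subset AB0.
by apply: hausdorff_dist_subset; rewrite // hausdorff_dist_sym.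
Qed.

Definition hausdorff_metric : metric R H := {|
  dist := fun A B : H => hausdorff_dist d (val A) (val B) ;
  dist_xx := fun A : H => hausdorff_dist_xx (val A) ;
  dist_positivity := hausdorff_dist_positivity ;
  dist_sym := fun A B : H => hausdorff_dist_sym (val A) (val B) ;
  dist_triangle := fun B A C : H =>
    hausdorff_dist_triangle (val B) (val A) (val C) |}.

End on_compact_subsets.
End hausdorff_metric.

(* Main.v *)
Require Import Defs.
From mathcomp Require Import all_boot all_order all_algebra.
From mathcomp Require Import all_classical all_reals.
From mathcomp Require Import topology.

Import Order.TTheory GRing.Theory Num.Theory.

Local Open Scope classical_set_scope.
Local Open Scope ring_scope.

(** By symmetry it suffices to show that the topology of [d_H] is contained in
    that of [d'_H] as soon as the topology of [d] is contained in that of [d'].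
    For metrics, inclusion of topologies means that around each point every
    [d]-ball contains a [d']-ball ([metric_topology_subP]); the radius of the
    smaller ball depends on the centre.  Over a compact set [A] it can be chosen
    uniformly ([compact_dist_uniform]): there is [r > 0] such that
    [d' a x < r] implies [d a x < e] whenever [a] lies in [A], for all [x].
    Only one of the two points has to lie in [A], so when [d'_H(A, B) < r]
    this applies both to a point of [A] and a nearby point of [B] and to a point
    of [B] and a nearby point of [A]; hence [d_H(A, B) <= e]
    ([hausdorff_topology_sub]).  The empty set is isolated for both metrics. *)

Lemma metric_topologyP {R : realType} {X : Type} (d : metric R X) (U : set X) :
  metric_topology d U <->
  forall x, U x -> exists2 e, 0 < e & forall y, d x y < e -> U y.
Proof.
rewrite /metric_topology openE /interior.
have nbhsd x : @nbhs _ (metric_space d) x U <->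
    exists2 e, 0 < e & forall y, d x y < e -> U y.
  by rewrite -(@metricType_numDomainType.filter_from_mdist_nbhs
                 R (metric_space d)).
by split=> + x Ux => /(_ x Ux)/nbhsd.
Qed.

Lemma metric_topology_subP {R : realType} {X : Type} (d d' : metric R X) :
  metric_topology d `<=` metric_topology d' <->
  forall x e, 0 < e ->
    exists2 r, 0 < r & forall y, d' x y < r -> d x y < e.
Proof.
split=> [sub x e e0|sub U /metric_topologyP dU].
  have /sub/metric_topologyP : metric_topology d [set y | d x y < e].
    apply/metric_topologyP => y /= xye; exists (e - d x y).
      by rewrite subr_gt0.
    move=> z yz; rewrite (le_lt_trans (dist_triangle d y x z))//.
    by rewrite -ltrBrDl.
  by apply; rewrite /= dist_xx.
apply/metric_topologyP => x /dU[e /(sub x)[r r0 rP] eU].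
by exists r => // y /rP/eU.
Qed.

(** A Lebesgue-number argument.  If [d' x y < r] implies [d x y < e / 2], then
    each [a] within [d'] distance [r / 2] of [x] admits the radius [r / 2],
    since [d a y <= d x a + d x y]; compactness makes the radius uniform. *)
Lemma compact_dist_uniform {R : realType} {X : Type} {d d' : metric R X}
    {A : set X} {e : R} :
  metric_topology d `<=` metric_topology d' -> compact_subsets d' A -> 0 < e ->
  exists2 r, 0 < r & forall a x, A a -> d' a x < r -> d a x < e.
Proof.
move=> /metric_topology_subP sub /compact_near_coveringP cA e0.
have e2 : 0 < e / 2 by rewrite divr_gt0.
have := cA R 0^'+ (fun r a => forall y, d' a y < r -> d a y < e)
              (@filter_filter _ _ (at_right_proper_filter 0)).
case=> [x _|r /= r0 rP].
  have [r r0 rP] := sub x _ e2.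
  have r2 : 0 < r / 2 by rewrite divr_gt0.
  exists ([set a | d' x a < r / 2], [set s | s < r / 2]) => /=.
    split; last exact: nbhs_right_lt.
    rewrite -(@metricType_numDomainType.filter_from_mdist_nbhs
                R (metric_space d')).
    by exists (r / 2).
  move=> [a s] /= [xa sr] y ays.
  have xar : d' x a < r by rewrite (lt_trans xa)// ltr_pdivrMr// ltr_pMr// ltr1n.
  have xyr : d' x y < r.
    rewrite (le_lt_trans (dist_triangle d' a x y))// [ltRHS]splitr.
    by rewrite ltrD// (lt_trans ays).
  rewrite (le_lt_trans (dist_triangle d x a y))// [ltRHS]splitr.
  by rewrite ltrD ?rP// dist_sym rP.
exists (r / 2); first by rewrite divr_gt0.
move=> a x Aa; apply: (rP (r / 2)) => //=; last by rewrite divr_gt0.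
rewrite sub0r normrN gtr0_norm ?divr_gt0//.
by rewrite ltr_pdivrMr// ltr_pMr// ltr1n.
Qed.

Lemma hausdorff_topology_sub {R : realType} {X : Type} {d d' : metric R X}
    (d1 : forall x y, d x y <= 1) (d'1 : forall x y, d' x y <= 1)
    {H : set (set X)} (HE : H = compact_subsets d)
    (HE' : H = compact_subsets d') :
  metric_topology d `<=` metric_topology d' ->
  metric_topology (hausdorff_metric d1 HE) `<=`
  metric_topology (hausdorff_metric d'1 HE').
Proof.
move=> sub; apply/metric_topology_subP => A e e0 /=.
have cA : compact_subsets d' (val A) by rewrite -HE'; exact: set_valP.
have e2 : 0 < e / 2 by rewrite divr_gt0.
have [r r0 rP] := compact_dist_uniform sub cA e2.
(* A radius at most 1 isolates the empty set from the nonempty ones. *)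
exists (Num.min r 1) => [|B]; first by rewrite lt_min r0 ltr01.
move=> ABr.
have [A0|A0] := eqVneq (val A) set0.
  move: ABr; rewrite /hausdorff_dist A0 eqxx.
  by case: ifP => // _; rewrite lt_min ltxx andbF.
have [B0|B0] := eqVneq (val B) set0.
  move: ABr; rewrite /hausdorff_dist B0 eqxx (negPf A0).
  by rewrite lt_min ltxx andbF.
move: A0 B0 => /set0P A0 /set0P B0.
have {}ABr : hausdorff_dist d' (val A) (val B) < r.
  by move: ABr; rewrite lt_min => /andP[].
have BAr : hausdorff_dist d' (val B) (val A) < r by rewrite hausdorff_dist_sym.
apply: (@le_lt_trans _ _ (e / 2)); last by rewrite ltr_pdivrMr// ltr_pMr// ltr1n.
apply: hausdorff_dist_le => // [a Aa|b Bb].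
  have [b Bb abr] := hausdorff_dist_lt d'1 A0 B0 ABr Aa.
  by exists b => //; apply/ltW/rP.
have [a Aa bar] := hausdorff_dist_lt d'1 B0 A0 BAr Bb.
by exists a => //; apply/ltW/rP => //; rewrite dist_sym.
Qed.

Theorem corollary3 (R : realType) (X : Type) (d d' : metric R X)
    (d1 : forall x y, d x y <= 1) (d'1 : forall x y, d' x y <= 1)
    (dd' : metric_topology d = metric_topology d') :
  metric_topology (hausdorff_metric d1 (erefl (compact_subsets d))) =
  metric_topology (hausdorff_metric d'1 (compact_subsets_eq dd')).
Proof.
by apply/seteqP; split; apply: hausdorff_topology_sub; rewrite dd'.
Qed.
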